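(* For every $J\in\mathbb Z_{>0}^m$, a puzzle $p\colon G(J)\to D'(K)$ is realizable if and only if all of its subsquares are realizable. Consequently, the D-J classes of $R$-characteristic maps over $K(J)$ are in bijection (via $\Lambda\mapsto(\boldsymbol\alpha\mapsto\operatorname{proj}_{\sigma(\boldsymbol\alpha)}\Lambda)$) with the puzzles $G(J)\to D'(K)$ all of whose subsquares are realizable.
   Context: Let $R\in\{\mathbb Z,\mathbb Z_2\}$; an $R$-basis of $R^n$ is a $\mathbb Z$-basis of $\mathbb Z^n$ ($R=\mathbb Z$) or a basis of $\mathbb Z_2^n$ ($R=\mathbb Z_2$). $K$ is an $(n-1)$-dimensional star-shaped simplicial sphere on $[m]$. An $R$-characteristic map over a complex with $(N-1)$-dimensional facets is a map from its vertices to $R^N$ sending each $(N-1)$-face to an $R$-basis; D-J equivalence is equality up to left multiplication by $GL_N(R)$. For a face $\sigma$, $\operatorname{proj}_\sigma\lambda$ is the characteristic map on $\operatorname{link}\sigma$ given by $w\mapsto[\lambda(w)]\in R^N/\langle\lambda(u):u\in\sigma\rangle$. For $J=(j_1,\dots,j_m)\in\mathbb Z_{>0}^m$, $K(J)$ is the complex on vertices $\{i_k:1\le i\le m,1\le k\le j_i\}$ whose minimal non-faces are $\bigcup_{i\in\tau}\{i_1,\dots,i_{j_i}\}$ for $\tau$ a minimal non-face of $K$; $\operatorname{wed}_vK=K(J)$ with $j_v=2$, other $j_i=1$. $I(J)=\{\boldsymbol\alpha:1\le\alpha_i\le j_i\}$; $\sigma(\boldsymbol\alpha)$ is the set of all vertices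 of $K(J)$ except $1_{\alpha_1},\dots,m_{\alpha_m}$, a face whose link is identified with $K$ via $i_{\alpha_i}\mapsto i$. The pre-diagram $D'(K)$: vertices are D-J classes of $R$-characteristic maps over $K$; an edge colored $v$ joins $\lambda_1,\lambda_2$ iff some $R$-characteristic map $\Lambda$ over $\operatorname{wed}_vK$ has $\operatorname{proj}_{v_1}\Lambda=\lambda_1$, $\operatorname{proj}_{v_2}\Lambda=\lambda_2$ (links of $v_1,v_2$ identified with $K$ by sending the other of $v_1,v_2$ to $v$). $G(J)$ is the $1$-skeleton of $\prod_i\Delta^{j_i-1}$ with vertex set $I(J)$, edges joining vertices differing in exactly one coordinate $v$, colored $v$. A puzzle of $(K,J)$ is a color-preserving graph homomorphism $G(J)\to D'(K)$; it is realizable if it equals $\boldsymbol\alpha\mapsto\operatorname{proj}_{\sigma(\boldsymbol\alpha)}\Lambda$ for some $R$-characteristic map $\Lambda$ over $K(J)$. For nonempty $S_i\subseteq[j_i]$, the restriction of a puzzle to the induced subgraph on $\prod_i S_i$, identified with $G(J')$, $j'_i=|S_i|$, via order-preserving bijections, is a subpuzzle (a puzzle of $(K,J')$); it is a subsquare if all $|S_i|\le2$ and exactly two of them equal $2$. *)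

(* Defs.v *)
From Stdlib Require Reals.
From HB Require Import structures.
From mathcomp Require Import all_boot all_order all_algebra.

Unset Strict Implicit.
Unset Printing Implicit Defensive.

Import GRing.Theory.

Definition simplicial_complex {m : nat} (K : {set {set 'I_m}}) : Prop :=
  [/\ set0 \in K,
      (forall s t : {set 'I_m}, t \subset s -> s \in K -> t \in K) &
      (forall i : 'I_m, [set i] \in K)].

Definition pure_dim {m : nat} (n : nat) (K : {set {set 'I_m}}) : Prop :=
  forall s, s \in K ->
    (#|s| <= n)%N /\ exists2 t, t \in K & (s \subset t) && (#|t| == n).

Definition RR := Reals.Rdefinitions.R.
Definition RR0 : RR := Reals.Rdefinitions.R0.
Definition RR1 : RR := Reals.Rdefinitions.R1.
Definition RRplus := Reals.Rdefinitions.Rplus.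
Definition RRmult := Reals.Rdefinitions.Rmult.
Definition RRle := Reals.Rdefinitions.Rle.

Definition rsum {T : Type} (s : seq T) (f : T -> RR) : RR :=
  foldr (fun x acc => RRplus (f x) acc) RR0 s.

Definition conv_hull {m n : nat} (pos : 'I_m -> 'I_n -> RR)
  (s : {set 'I_m}) (x : 'I_n -> RR) : Prop :=
  exists w : 'I_m -> RR,
    [/\ (forall i, i \in s -> RRle RR0 (w i)),
        rsum (enum s) w = RR1 &
        (forall k, x k = rsum (enum s) (fun i => RRmult (w i) (pos i k)))].

Definition aff_indep {m n : nat} (pos : 'I_m -> 'I_n -> RR) (s : {set 'I_m}) :=
  forall w : 'I_m -> RR,
    rsum (enum s) w = RR0 ->
    (forall k, rsum (enum s) (fun i => RRmult (w i) (pos i k)) = RR0) ->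
    forall i, i \in s -> w i = RR0.

Definition geom_realization {m n : nat} (K : {set {set 'I_m}})
  (pos : 'I_m -> 'I_n -> RR) : Prop :=
  (forall s, s \in K -> aff_indep pos s) /\
  (forall s t, s \in K -> t \in K -> forall x,
      conv_hull pos s x -> conv_hull pos t x -> conv_hull pos (s :&: t) x).

Definition polyhedron {m n : nat} (K : {set {set 'I_m}})
  (pos : 'I_m -> 'I_n -> RR) (x : 'I_n -> RR) : Prop :=
  exists2 s, s \in K & conv_hull pos s x.

Definition star_shaped {m : nat} (n : nat) (K : {set {set 'I_m}}) : Prop :=
  exists pos : 'I_m -> 'I_n -> RR, geom_realization K pos /\
  exists p : 'I_n -> RR, forall d : 'I_n -> RR, (exists k, d k <> RR0) ->
    exists! t : RR, RRle RR0 t /\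
      polyhedron K pos (fun k => RRplus (p k) (RRmult t (d k))).

Definition star_shaped_sphere {m : nat} (n : nat) (K : {set {set 'I_m}}) : Prop :=
  [/\ simplicial_complex K, pure_dim n K & star_shaped n K].

Inductive coef := CZ | CZ2.

Definition cring (c : coef) : comUnitRingType :=
  match c with CZ => int | CZ2 => 'Z_2 end.

Local Open Scope ring_scope.

Definition is_basis {V : finType} {c : coef} {d : nat} (A : {set V})
  (f : V -> 'cV[cring c]_d) : Prop :=
  (forall x : 'cV[cring c]_d,
      exists a : V -> cring c, x = \sum_(v in A) a v *: f v) /\
  (forall a : V -> cring c, \sum_(v in A) a v *: f v = 0 ->
      forall v, v \in A -> a v = 0).

Definition charmap {V : finType} {c : coef} {d : nat} (F : {set V} -> Prop)
  (f : V -> 'cV[cring c]_d) : Prop :=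
  forall s : {set V}, F s -> #|s| = d -> is_basis s f.

Definition DJ {V : finType} {c : coef} {d : nat}
  (f g : V -> 'cV[cring c]_d) : Prop :=
  exists2 M : 'M[cring c]_d, M \in unitmx & forall v, g v = M *m f v.

Definition in_span {V : finType} {c : coef} {d : nat} (A : {set V})
  (f : V -> 'cV[cring c]_d) (x : 'cV[cring c]_d) : Prop :=
  exists a : V -> cring c, x = \sum_(v in A) a v *: f v.

(* vertices i_k, 1 <= k <= J i, encoded 0-based as (i, k-1) *)
Definition VJ {m : nat} (J : 'I_m -> nat) : finType := {i : 'I_m & 'I_(J i)}.

Definition min_nonface {m : nat} (K : {set {set 'I_m}}) (t : {set 'I_m}) : bool :=
  (t \notin K) && [forall i in t, (t :\ i) \in K].

Definition blowup {m : nat} (J : 'I_m -> nat) (t : {set 'I_m}) : {set VJ J} :=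
  [set x : VJ J | tag x \in t].

(* faces of K(J): sets of vertices containing no minimal non-face of K(J),
   whose minimal non-faces are the blow-ups of minimal non-faces of K *)
Definition faceJ {m : nat} (K : {set {set 'I_m}}) (J : 'I_m -> nat)
  (S : {set VJ J}) : Prop :=
  forall t, min_nonface K t -> ~ (blowup J t \subset S).

(* K(J) has (N-1)-dimensional facets, N = n + sum_i (j_i - 1) *)
Definition dimJ (n : nat) {m : nat} (J : 'I_m -> nat) : nat :=
  (n + \sum_(i < m) (J i).-1)%N.

Definition charmapJ {c : coef} {n m : nat} (K : {set {set 'I_m}})
  {J : 'I_m -> nat} (L : VJ J -> 'cV[cring c]_(dimJ n J)) : Prop :=
  charmap (faceJ K J) L.

(* I(J), 0-based: alpha i < J i *)
Definition in_IJ {m : nat} (J : 'I_m -> nat) (a : {ffun 'I_m -> nat}) : Prop :=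
  forall i, (a i < J i)%N.

Definition sigma_of {m : nat} (J : 'I_m -> nat) (a : {ffun 'I_m -> nat})
  : {set VJ J} := [set x : VJ J | val (tagged x) != a (tag x)].

(* "proj_{sigma(alpha)} L = mu" as D-J classes of characteristic maps over K,
   link(sigma(alpha)) being identified with K via i_{alpha_i} |-> i: mu is
   obtained from L by composing with a surjective linear map R^N -> R^n whose
   kernel is the span of L(sigma(alpha)) (i.e. with the quotient map
   R^N -> R^N / <L(u) : u in sigma(alpha)> followed by an isomorphism). *)
Definition proj_is {c : coef} {n m : nat} {J : 'I_m -> nat}
  (a : {ffun 'I_m -> nat}) (L : VJ J -> 'cV[cring c]_(dimJ n J))
  (mu : 'I_m -> 'cV[cring c]_n) : Prop :=
  exists P : 'M[cring c]_(n, dimJ n J),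
    [/\ (forall y : 'cV[cring c]_n, exists x, P *m x = y),
        (forall x, P *m x = 0 <-> in_span (sigma_of J a) L x) &
        (forall x : VJ J, val (tagged x) = a (tag x) -> mu (tag x) = P *m L x)].

(* wed_v K = K(J) with j_v = 2, other j_i = 1 *)
Definition Jwed {m : nat} (v : 'I_m) : 'I_m -> nat :=
  fun i => if i == v then 2%N else 1%N.

(* alpha with sigma(alpha) = {v_1}  (alpha_v = 2, 1-based) *)
Definition a_v1 {m : nat} (v : 'I_m) : {ffun 'I_m -> nat} :=
  [ffun i => if i == v then 1%N else 0%N].
(* alpha with sigma(alpha) = {v_2}  (all alpha_i = 1, 1-based) *)
Definition a_v2 (m : nat) : {ffun 'I_m -> nat} := [ffun _ => 0%N].

Definition edgeD {c : coef} {n m : nat} (K : {set {set 'I_m}}) (v : 'I_m)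
  (l1 l2 : 'I_m -> 'cV[cring c]_n) : Prop :=
  exists L : VJ (Jwed v) -> 'cV[cring c]_(dimJ n (Jwed v)),
    [/\ charmapJ K L, proj_is (a_v1 v) L l1 & proj_is (a_v2 m) L l2].

Definition gedge {m : nat} (v : 'I_m) (a b : {ffun 'I_m -> nat}) : Prop :=
  a v <> b v /\ forall i, i != v -> a i = b i.

(* a puzzle of (K,J), each D-J class being given by a representative *)
Definition is_puzzle {c : coef} {n m : nat} (K : {set {set 'I_m}})
  (J : 'I_m -> nat) (p : {ffun 'I_m -> nat} -> 'I_m -> 'cV[cring c]_n) : Prop :=
  (forall a, in_IJ J a -> charmap (fun s => s \in K) (p a)) /\
  (forall a b v, in_IJ J a -> in_IJ J b -> gedge v a b ->
     edgeD K v (p a) (p b)).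

Definition realizes {c : coef} {n m : nat} (K : {set {set 'I_m}})
  {J : 'I_m -> nat} (L : VJ J -> 'cV[cring c]_(dimJ n J))
  (p : {ffun 'I_m -> nat} -> 'I_m -> 'cV[cring c]_n) : Prop :=
  charmapJ K L /\ forall a, in_IJ J a -> proj_is a L (p a).

Definition realizable {c : coef} {n m : nat} (K : {set {set 'I_m}})
  (J : 'I_m -> nat) (p : {ffun 'I_m -> nat} -> 'I_m -> 'cV[cring c]_n) : Prop :=
  exists L : VJ J -> 'cV[cring c]_(dimJ n J), realizes K L p.

(* all subsquares are realizable: for all S_i subset [j_i], given through
   the order-preserving injections f_i : [j'_i] -> [j_i] with image S_i,
   with all j'_i in {1,2} and exactly two equal to 2 *)
Definition subsquares_realizable {c : coef} {n m : nat}
  (K : {set {set 'I_m}}) (J : 'I_m -> nat)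
  (p : {ffun 'I_m -> nat} -> 'I_m -> 'cV[cring c]_n) : Prop :=
  forall (J' : 'I_m -> nat) (f : 'I_m -> nat -> nat),
    (forall i, (0 < J' i <= 2)%N) ->
    #|[set i | J' i == 2%N]| = 2%N ->
    (forall i k, (k < J' i)%N -> (f i k < J i)%N) ->
    (forall i k l, (k < l)%N -> (l < J' i)%N -> (f i k < f i l)%N) ->
    realizable K J' (fun b => p [ffun i => f i (b i)]).

(* Main.v *)
Require Import Defs.
From HB Require Import structures.
From mathcomp Require Import all_boot all_order all_algebra.

(* A characteristic map over K(J) is determined, up to D-J equivalence, by its
   projections at the base point and at the points of I(J) differing from it in
   one coordinate: they prescribe the rows of a normal form.  Conversely the
   edges of a puzzle at the base point make this normal form project correctly
   at these points.  At a point with two further nonzero coordinates, reset them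
   to the base value; three corners of the resulting square are known by
   induction on the number of nonzero coordinates, so the realization of that
   subsquare must be D-J equivalent to the restriction of the normal form, which
   therefore has the right projection at the fourth corner too. *)

Set Implicit Arguments.
Unset Strict Implicit.
Unset Printing Implicit Defensive.

Import GRing.Theory.
Local Open Scope ring_scope.

(** * Bases and spans *)

Lemma set_enumeration (V : finType) (d : nat) (A : {set V}) : #|A| = d ->
  exists e : 'I_d -> V, [/\ injective e, forall j, e j \in A,
    forall v, v \in A -> exists j, v = e j &
    forall (M : nmodType) (F : V -> M),
      \sum_(v in A) F v = \sum_j F (e j)].
Proof.
move=> <-; exists (@enum_val V (mem A)).
split; [exact: enum_val_inj | exact: enum_valP | |].
  by move=> v Av; exists (enum_rank_in Av v); rewrite enum_rankK_in.
by move=> M F; rewrite big_enum_val.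
Qed.

Lemma col_sum_delta (R : nzRingType) (d : nat) (x : 'cV[R]_d) :
  x = \sum_j x j 0 *: col j 1%:M.
Proof.
apply/matrixP => i j; rewrite summxE (bigD1 i) //= big1 ?addr0.
  by rewrite !mxE eqxx mulr1 (ord1 j).
by move=> k /negbTE ki; rewrite !mxE eq_sym ki mulr0.
Qed.

Lemma surj_right_inverse (R : nzRingType) (a b : nat) (P : 'M[R]_(a, b)) :
  (forall y : 'cV_a, exists x, P *m x = y) -> exists S, P *m S = 1%:M.
Proof.
move=> sP; have [g gP] := fin_all_exists (fun j : 'I_a => sP (col j 1%:M)).
exists (\matrix_(i, j) g j i 0); apply/matrixP => i j.
transitivity ((P *m g j) i 0); last by rewrite gP mxE.
by rewrite !mxE; apply: eq_bigr => k _; rewrite !mxE.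
Qed.

(** With [S] a right inverse of [Q], each $x - SQx$ lies in the kernel of [Q], hence in that of [P],
    so $P = (PS)Q$. *)
Lemma surj_factor (R : nzRingType) (a b d : nat) (P : 'M[R]_(a, d))
  (Q : 'M[R]_(b, d)) :
  (forall y : 'cV_b, exists x, Q *m x = y) ->
  (forall x : 'cV_d, Q *m x = 0 -> P *m x = 0) -> exists U, P = U *m Q.
Proof.
move=> /surj_right_inverse[S QS] kQ; exists (P *m S).
have col_eq0 : forall x : 'cV_d, P *m x = P *m S *m Q *m x.
  move=> x; apply/eqP; rewrite -subr_eq0 -!mulmxA -mulmxBr; apply/eqP/kQ.
  by rewrite mulmxBr (mulmxA Q S) QS mul1mx subrr.
apply/matrixP => i j; have /matrixP/(_ i 0) := col_eq0 (col j 1%:M).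
by rewrite !colE !mul1mx -!colE !mxE.
Qed.

Lemma in_span_sum (c : coef) (V : finType) (d : nat) (A B : {set V})
  (f : V -> 'cV[cring c]_d) (a : V -> cring c) :
  A \subset B -> in_span B f (\sum_(v in A) a v *: f v).
Proof.
move=> /subsetP AB; exists (fun v => if v \in A then a v else 0).
rewrite [RHS](bigID (mem A)) /= [X in _ + X]big1 ?addr0; last first.
  by move=> v /andP[_ /negbTE ->]; rewrite scale0r.
apply: eq_big => v; last by move=> ->.
by case: (boolP (v \in A)) => [/AB ->|]; rewrite ?andbF.
Qed.

Lemma in_spanD (c : coef) (V : finType) (d : nat) (A : {set V})
  (f : V -> 'cV[cring c]_d) (x y : 'cV[cring c]_d) :
  in_span A f x -> in_span A f y -> in_span A f (x + y).
Proof.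
move=> [a ->] [b ->]; exists (fun v => a v + b v).
by rewrite -big_split; apply: eq_bigr => v _; rewrite scalerDl.
Qed.

Lemma in_spanZ (c : coef) (V : finType) (d : nat) (A : {set V})
  (f : V -> 'cV[cring c]_d) (k : cring c) (x : 'cV[cring c]_d) :
  in_span A f x -> in_span A f (k *: x).
Proof.
move=> [a ->]; exists (fun v => k * a v); rewrite scaler_sumr.
by apply: eq_bigr => v _; rewrite scalerA.
Qed.

Lemma in_span_bigsum (c : coef) (V I : finType) (d : nat) (A : {set V})
  (f : V -> 'cV[cring c]_d) (P : pred I) (F : I -> 'cV[cring c]_d) :
  (forall i, P i -> in_span A f (F i)) -> in_span A f (\sum_(i | P i) F i).
Proof.
move=> FA; apply: big_ind => //; last by move=> x y; apply: in_spanD.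
by exists (fun=> 0); rewrite big1 // => v _; rewrite scale0r.
Qed.

Lemma in_span_sub (c : coef) (V : finType) (d : nat) (A B : {set V})
  (f : V -> 'cV[cring c]_d) (x : 'cV[cring c]_d) :
  A \subset B -> in_span A f x -> in_span B f x.
Proof. by move=> AB [a ->]; apply: in_span_sum. Qed.

Lemma mulmx_span0 (c : coef) (V : finType) (d e : nat) (A : {set V})
  (f : V -> 'cV[cring c]_d) (P : 'M[cring c]_(e, d)) (x : 'cV[cring c]_d) :
  (forall v, v \in A -> P *m f v = 0) -> in_span A f x -> P *m x = 0.
Proof.
move=> Pf [a ->]; rewrite mulmx_sumr big1 // => v Av.
by rewrite -scalemxAr Pf ?scaler0.
Qed.

Lemma in_span_vertex (c : coef) (V : finType) (d : nat) (A : {set V})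
  (f : V -> 'cV[cring c]_d) (v : V) : v \in A -> in_span A f (f v).
Proof.
move=> Av; have := @in_span_sum _ _ _ [set v] A f (fun=> 1).
by rewrite sub1set big_set1 scale1r; apply.
Qed.

(** The square matrix with these vectors as columns has a right inverse, which over a commutative
    ring is also a left inverse; this gives independence. *)
Lemma spanning_basis (c : coef) (V : finType) (d : nat) (A : {set V})
  (f : V -> 'cV[cring c]_d) :
  #|A| = d -> (forall x, in_span A f x) -> is_basis A f.
Proof.
move=> cA spA; split=> // a a0 v Av.
have [e [_ eA Ae sume]] := set_enumeration cA.
pose F := \matrix_(i, j) f (e j) i 0.
have F_mul (b : V -> cring c) :
    F *m (\col_j b (e j)) = \sum_(v in A) b v *: f v.
  rewrite sume; apply/matrixP => i j; rewrite !mxE summxE.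
  by apply: eq_bigr => k _; rewrite !mxE (ord1 j) mulrC.
have [S /mulmx1C SF]: exists S, F *m S = 1%:M.
  apply: surj_right_inverse => y; have [b ->] := spA y.
  by exists (\col_j b (e j)).
have [j ->] := Ae v Av.
have := congr1 (mulmx S) (F_mul a).
by rewrite a0 mulmxA SF mul1mx mulmx0 => /matrixP/(_ j 0); rewrite !mxE.
Qed.

(** The coordinate functionals, as row vectors: [D v] collects the [v]-coordinates of the standard
    basis vectors. *)
Lemma dual_basis (c : coef) (V : finType) (d : nat) (A : {set V})
  (f : V -> 'cV[cring c]_d) : is_basis A f ->
  exists D : V -> 'rV[cring c]_d,
    (forall x, x = \sum_(v in A) (D v *m x) 0 0 *: f v) /\
    (forall v w, v \in A -> w \in A -> (D v *m f w) 0 0 = (v == w)%:R).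
Proof.
move=> [spA indA].
have [g gP] := fin_all_exists (fun j : 'I_d => spA (col j 1%:M)).
pose D v := \row_j g j v.
have DE x : x = \sum_(v in A) (D v *m x) 0 0 *: f v.
  rewrite [LHS]col_sum_delta.
  under eq_bigr => j _ do rewrite (gP j) scaler_sumr.
  rewrite exchange_big; apply: eq_bigr => v _.
  rewrite mxE scaler_suml; apply: eq_bigr => j _.
  by rewrite !mxE scalerA mulrC.
exists D; split=> // v w Av Aw.
have /indA : \sum_(u in A) ((D u *m f w) 0 0 - (u == w)%:R) *: f u = 0.
  under eq_bigr => u _ do rewrite scalerBl.
  rewrite sumrB -DE (bigD1 w) //= eqxx scale1r big1 ?addr0 ?subrr //.
  by move=> u /andP[_ /negbTE ->]; rewrite scale0r.
by move=> /(_ v Av)/eqP; rewrite subr_eq0 => /eqP.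
Qed.

(** The quotient by the span of [T] in coordinates: the rows of [Q] are the functionals dual to the
    basis vectors outside [T]. *)
Lemma basis_quotient (c : coef) (V : finType) (d e : nat) (F T : {set V})
  (f : V -> 'cV[cring c]_d) :
  is_basis F f -> T \subset F -> #|F :\: T| = e ->
  exists Q : 'M[cring c]_(e, d),
    (forall y : 'cV_e, exists x, Q *m x = y) /\
    (forall x, Q *m x = 0 <-> in_span T f x).
Proof.
move=> /dual_basis[D [DE Df]] /[dup] TF /subsetP TsF.
move=> /set_enumeration[h [hinj hA Ah sumh]].
have hF j : h j \in F by have := hA j; rewrite in_setD => /andP[].
have hT j : h j \notin T by have := hA j; rewrite in_setD => /andP[].
pose Q := \matrix_(i < e, j < d) D (h i) 0 j.
have QE x i : (Q *m x) i 0 = (D (h i) *m x) 0 0.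
  by rewrite !mxE; apply: eq_bigr => k _; rewrite !mxE.
exists Q; split.
  move=> y; exists (\sum_j y j 0 *: f (h j)).
  apply/matrixP => i j; rewrite (ord1 j) mulmx_sumr summxE (bigD1 i) //=.
  rewrite -scalemxAr mxE QE Df // eqxx mulr1 big1 ?addr0 // => k ki.
  by rewrite -scalemxAr mxE QE Df // (inj_eq hinj) eq_sym (negbTE ki) mulr0.
move=> x; split=> [Qx|].
  exists (fun v => (D v *m x) 0 0); rewrite [LHS]DE (big_setID T) /=.
  rewrite (setIidPr TF) sumh [X in _ + X]big1 ?addr0 // => j _.
  by rewrite -QE Qx mxE scale0r.
apply: mulmx_span0 => v Tv; apply/matrixP => i j; rewrite (ord1 j) QE [RHS]mxE.
rewrite (Df _ _ (hF i) (TsF _ Tv)) (_ : h i == v = false) //; apply/negbTE.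
by apply: contraNneq (hT i) => ->.
Qed.

(** * Facets of K(J) and projections *)

(** The union of $\sigma(\alpha)$ with the vertices $i_{\alpha_i}$ for $i\in t$; when [t] runs
    through the facets of [K], these are the facets of $K(J)$. *)
Definition facetJ (m : nat) (J : 'I_m -> nat) (a : {ffun 'I_m -> nat})
  (t : {set 'I_m}) : {set VJ J} :=
  [set x : VJ J | (val (tagged x) != a (tag x)) || (tag x \in t)].

Definition vertex (m : nat) (J : 'I_m -> nat) (i : 'I_m) (k : 'I_(J i)) : VJ J :=
  Tagged (fun i => 'I_(J i)) k.

Lemma vertexP (m : nat) (J : 'I_m -> nat) (x y : VJ J) :
  tag x = tag y -> val (tagged x) = val (tagged y) -> x = y.
Proof.
case: x y => [i k] [j l] /= ij; case: j / ij l => l /= kl.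
by congr existT; apply: val_inj.
Qed.

Lemma sigma_sub_facetJ (m : nat) (J : 'I_m -> nat) (a : {ffun 'I_m -> nat})
  (t : {set 'I_m}) : sigma_of J a \subset facetJ J a t.
Proof. by apply/subsetP => x; rewrite !inE => ->. Qed.

Lemma in_facetJD (m : nat) (J : 'I_m -> nat) (a : {ffun 'I_m -> nat})
  (t : {set 'I_m}) (x : VJ J) :
  x \in facetJ J a t :\: sigma_of J a -> val (tagged x) = a (tag x) /\ tag x \in t.
Proof.
rewrite !inE negbK => /andP[/eqP xa]; rewrite xa eqxx /=; by split.
Qed.

(** Over $i\in t$ all [J i] vertices are present, over any other [i] all but $i_{\alpha_i}$. *)
Lemma card_facetJ (m : nat) (J : 'I_m -> nat) (a : {ffun 'I_m -> nat})
  (t : {set 'I_m}) : in_IJ J a ->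
  #|facetJ J a t| = (#|t| + \sum_(i < m) (J i).-1)%N.
Proof.
move=> Ja; rewrite -sum1dep_card.
rewrite -(sig_big_dep predT
  (fun i (k : 'I_(J i)) => (val k != a i) || (i \in t)) (fun _ _ => 1%N)) /=.
rewrite -sum1_card [X in (X + _)%N]big_mkcond -big_split /=.
apply: eq_bigr => i _; rewrite sum1dep_card.
case: (boolP (i \in t)) => _.
  rewrite (eq_card (B := predT)) => [|k]; last by rewrite inE orbT.
  by rewrite card_ord add1n prednK // (leq_trans _ (Ja i)).
rewrite (eq_card (B := predC1 (Ordinal (Ja i)))) => [|k].
  by rewrite cardC1 card_ord.
by rewrite !inE orbF.
Qed.

Lemma card_sigma (m : nat) (J : 'I_m -> nat) (a : {ffun 'I_m -> nat}) :
  in_IJ J a -> #|sigma_of J a| = (\sum_(i < m) (J i).-1)%N.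
Proof.
move=> Ja; have := card_facetJ set0 Ja; rewrite cards0 add0n => <-.
by apply: eq_card => x; rewrite !inE orbF.
Qed.

Lemma card_facetJD (m : nat) (J : 'I_m -> nat) (a : {ffun 'I_m -> nat})
  (t : {set 'I_m}) : in_IJ J a -> #|facetJ J a t :\: sigma_of J a| = #|t|.
Proof.
move=> Ja; rewrite cardsD (setIidPr (sigma_sub_facetJ _ _ _)).
by rewrite card_facetJ // card_sigma // addnK.
Qed.

Lemma sum_facetJD (M : nmodType) (m : nat) (J : 'I_m -> nat)
  (a : {ffun 'I_m -> nat}) (ha : in_IJ J a) (t : {set 'I_m}) (F : VJ J -> M) :
  \sum_(x in facetJ J a t :\: sigma_of J a) F x =
  \sum_(i in t) F (vertex (Ordinal (ha i))).
Proof.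
rewrite (reindex_onto (fun i => vertex (Ordinal (ha i))) (@tag _ _)) /=.
  by apply: eq_bigl => i; rewrite !inE /= !eqxx /= andbT.
by move=> x /in_facetJD[xa _]; apply: vertexP.
Qed.

Lemma exists_min_nonface (m : nat) (K : {set {set 'I_m}}) (t : {set 'I_m}) :
  t \notin K -> exists2 s, min_nonface K s & s \subset t.
Proof.
move=> /(minset_exists (P := fun s => s \notin K))[s /minsetP[sK smin] st].
exists s => //; rewrite /min_nonface sK /=; apply/forall_inP => i si.
apply/negPn/negP => /smin/(_ (subsetDl _ _)) ssi.
by move: si; rewrite -ssi !inE eqxx.
Qed.

(** If the set contains the blow-up of [s], it contains $i_{\alpha_i}$ for every $i\in s$, which
    forces $s\subseteq t$; so [s] is a face. *)
Lemma facetJ_face (m : nat) (K : {set {set 'I_m}}) (J : 'I_m -> nat)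
  (a : {ffun 'I_m -> nat}) (t : {set 'I_m}) :
  simplicial_complex K -> in_IJ J a -> t \in K -> faceJ K J (facetJ J a t).
Proof.
move=> [_ down _] Ja tK s /andP[/negP sK _] /subsetP sub; case: sK.
apply: down tK; apply/subsetP => i si.
by have := sub (vertex (Ordinal (Ja i))); rewrite !inE /= eqxx; apply.
Qed.

(** Let [t] consist of the [i] all of whose vertices lie in [S], and for the other [i] let [a i] be
    a missing vertex. Then [t] is a face and [S] lies in [facetJ J a t]; counting gives equality. *)
Lemma faceJ_facetJ (n m : nat) (K : {set {set 'I_m}}) (J : 'I_m -> nat)
  (S : {set VJ J}) : pure_dim n K -> (forall i, 0 < J i)%N ->
  faceJ K J S -> #|S| = dimJ n J ->
  exists a t, [/\ in_IJ J a, t \in K, #|t| = n & S = facetJ J a t].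
Proof.
move=> pK hJ fS cS.
pose t := [set i | [forall k : 'I_(J i), vertex k \in S]].
have tK : t \in K.
  apply/negPn/negP => /exists_min_nonface[s /fS sS /subsetP st].
  apply: sS; apply/subsetP => x; rewrite inE => /st; rewrite inE => /forallP.
  by move=> /(_ (tagged x)); case: x.
(* For [i] in [t] no vertex is missing, and index 0 is a mere default. *)
have /fin_all_exists[g gP] (i : 'I_m) :
    exists k : 'I_(J i), i \notin t -> vertex k \notin S.
  have [it|it] := boolP (i \in t); first by exists (Ordinal (hJ i)).
  have := it; rewrite inE negb_forall => /existsP[k kS]; by exists k.
pose a : {ffun 'I_m -> nat} := [ffun i => val (g i)].
have Ja : in_IJ J a by move=> i; rewrite ffunE ltn_ord.
have sub : S \subset facetJ J a t.
  apply/subsetP => x xS; rewrite inE -implyNb negbK.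
  apply/implyP => /eqP; rewrite ffunE => xg.
  apply/negPn/negP => /gP; rewrite -(_ : x = vertex (g (tag x))) ?xS //.
  exact: vertexP.
have [tn _] := pK _ tK.
have cF := card_facetJ t Ja.
have := subset_leq_card sub; rewrite cS cF leq_add2r => nt.
have tE : #|t| = n by apply/eqP; rewrite eqn_leq tn nt.
by exists a, t; split=> //; apply/eqP; rewrite eqEcard sub cF cS tE leqnn.
Qed.

Lemma charmapJ_facetJ (c : coef) (n m : nat) (K : {set {set 'I_m}})
  (J : 'I_m -> nat) (L : VJ J -> 'cV[cring c]_(dimJ n J))
  (a : {ffun 'I_m -> nat}) (t : {set 'I_m}) :
  simplicial_complex K -> charmapJ K L -> in_IJ J a -> t \in K -> #|t| = n ->
  is_basis (facetJ J a t) L.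
Proof.
move=> sK LK Ja tK tn; apply: LK; first exact: facetJ_face.
by rewrite card_facetJ ?tn.
Qed.

(** * Projections and bases of facets *)

Section Projections.
Variables (c : coef) (n m : nat) (J : 'I_m -> nat).
Variable (L : VJ J -> 'cV[cring c]_(dimJ n J)).
Implicit Types (a : {ffun 'I_m -> nat}) (t : {set 'I_m})
  (mu : 'I_m -> 'cV[cring c]_n).

Lemma mulmx_sum_facetJ a (ha : in_IJ J a) t mu (P : 'M[cring c]_(n, dimJ n J))
    (b : VJ J -> cring c) :
  (forall x, x \in sigma_of J a -> P *m L x = 0) ->
  (forall x : VJ J, val (tagged x) = a (tag x) -> mu (tag x) = P *m L x) ->
  P *m (\sum_(x in facetJ J a t) b x *: L x) =
  \sum_(i in t) b (vertex (Ordinal (ha i))) *: mu i.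
Proof.
move=> P0 Pmu; rewrite (big_setID (sigma_of J a)) /=.
rewrite (setIidPr (sigma_sub_facetJ _ _ _)) mulmxDr.
rewrite (mulmx_span0 P0 (in_span_sum L b (subxx _))) add0r.
rewrite (sum_facetJD ha) mulmx_sumr; apply: eq_bigr => i _.
by rewrite -scalemxAr -Pmu.
Qed.

Lemma proj_is_sigma0 a mu (P : 'M[cring c]_(n, dimJ n J)) :
  (forall x, P *m x = 0 <-> in_span (sigma_of J a) L x) ->
  forall x, x \in sigma_of J a -> P *m L x = 0.
Proof. by move=> kP x xa; apply/kP/in_span_vertex. Qed.

(** Expanding $Px$ in the basis [mu] and lifting the expansion leaves a vector of $\ker P$, which is
    spanned by $\sigma(\alpha)$. So the facet spans, and its cardinality does the rest. *)
Lemma proj_basis a t mu : in_IJ J a -> proj_is a L mu -> #|t| = n ->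
  is_basis t mu -> is_basis (facetJ J a t) L.
Proof.
move=> ha [P [sP kP Pmu]] tn [spt _]; apply: spanning_basis.
  by rewrite card_facetJ ?tn.
move=> x; have [b bE] := spt (P *m x).
pose y := \sum_(v in facetJ J a t) b (tag v) *: L v.
have Py : P *m (x - y) = 0.
  rewrite mulmxBr (mulmx_sum_facetJ ha _ _ (proj_is_sigma0 mu kP) Pmu) /=.
  by rewrite -bE subrr.
rewrite -(subrK y x); apply: in_spanD.
  by apply: in_span_sub (sigma_sub_facetJ _ _ _) _; apply/kP.
by exists (fun v => b (tag v)).
Qed.

Lemma proj_span a t mu : in_IJ J a -> proj_is a L mu -> #|t| = n ->
  is_basis (facetJ J a t) L -> is_basis t mu.
Proof.
move=> ha [P [sP kP Pmu]] tn [spF _]; apply: spanning_basis => // y.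
have [x <-] := sP y; have [b ->] := spF x.
rewrite (mulmx_sum_facetJ ha _ _ (proj_is_sigma0 mu kP) Pmu).
by eexists.
Qed.

(** Once the facet is a basis, the values of [P] on vertices suffice: a vector killed by [P] has
    zero coordinates outside $\sigma(\alpha)$, by independence of [mu] on [t]. *)
Lemma proj_intro a t mu (P : 'M[cring c]_(n, dimJ n J)) : in_IJ J a ->
  is_basis t mu -> is_basis (facetJ J a t) L ->
  (forall x : VJ J, P *m L x =
     if val (tagged x) == a (tag x) then mu (tag x) else 0) ->
  proj_is a L mu.
Proof.
move=> ha [spt indt] [spF _] PL.
have P0 x : x \in sigma_of J a -> P *m L x = 0.
  by rewrite inE PL => /negbTE ->.
have Pmu (x : VJ J) : val (tagged x) = a (tag x) -> mu (tag x) = P *m L x.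
  by rewrite PL => ->; rewrite eqxx.
exists P; split=> // [y|x].
  have [b ->] := spt y.
  exists (\sum_(v in facetJ J a t) b (tag v) *: L v).
  by rewrite (mulmx_sum_facetJ ha _ _ P0 Pmu).
split; last exact: mulmx_span0.
have [b ->] := spF x.
rewrite (mulmx_sum_facetJ ha _ _ P0 Pmu) => /indt b0.
exists b; rewrite (big_setID (sigma_of J a)) /=.
rewrite (setIidPr (sigma_sub_facetJ _ _ _)) (sum_facetJD ha).
by rewrite [X in _ + X]big1 ?addr0 // => i ti; rewrite b0 ?scale0r.
Qed.

Lemma proj_exists a t : in_IJ J a -> #|t| = n -> is_basis (facetJ J a t) L ->
  exists mu, proj_is a L mu.
Proof.
move=> ha tn bF.
have [P [sP kP]] := basis_quotient bF (sigma_sub_facetJ J a t)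
  (etrans (card_facetJD t ha) tn).
exists (fun i => P *m L (vertex (Ordinal (ha i)))), P; split=> // x xa.
by congr (_ *m L _); apply: vertexP.
Qed.

End Projections.

(** * Restriction to a sub-box of $I(J)$ *)

(** The vertices outside the sub-box lie in $\sigma(\alpha)$ for every point of the sub-box, so
    dividing by their span first changes none of the projections there. The maps [f i] are injective
    rather than increasing so that an edge can be restricted to in either direction. *)
Lemma restriction (c : coef) (n m : nat) (J J' : 'I_m -> nat)
  (f : 'I_m -> nat -> nat) (L : VJ J -> 'cV[cring c]_(dimJ n J))
  (b0 : {ffun 'I_m -> nat}) (t : {set 'I_m}) :
  (forall i k, k < J' i -> f i k < J i)%N ->
  (forall i k l, (k < J' i)%N -> (l < J' i)%N -> f i k = f i l -> k = l) ->
  in_IJ J' b0 -> #|t| = n -> is_basis (facetJ J [ffun i => f i (b0 i)] t) L ->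
  exists L' : VJ J' -> 'cV[cring c]_(dimJ n J'),
    forall b mu, in_IJ J' b ->
      proj_is b L' mu <-> proj_is [ffun i => f i (b i)] L mu.
Proof.
move=> hf finj hb0 tn bF.
pose g (y : VJ J') : VJ J := vertex (Ordinal (hf _ _ (ltn_ord (tagged y)))).
have ginj : injective g.
  move=> x y gxy; have txy : tag x = tag y := congr1 (@tag _ _) gxy.
  apply: vertexP => //.
  have gv : f (tag x) (val (tagged x)) = f (tag y) (val (tagged y)).
    exact: (congr1 (fun z : VJ J => val (tagged z)) gxy).
  apply: (finj (tag x)); [exact: ltn_ord | by rewrite txy ltn_ord |].
  by rewrite gv txy.
have gE b (hb : in_IJ J' b) (x : VJ J) :
    val (tagged x) = f (tag x) (b (tag x)) ->
    x = g (vertex (Ordinal (hb (tag x)))).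
  by move=> xb; apply: vertexP.
pose T := ~: [set g y | y : VJ J'].
have TP x : x \in T \/ exists y, x = g y.
  rewrite inE; have [/imsetP[y _ ->]|_] := boolP (x \in _); last by left.
  by right; exists y.
have gT y : g y \notin T by rewrite inE negbK imset_f.
have sigmaT b x : in_IJ J' b -> x \in T -> x \in sigma_of J [ffun i => f i (b i)].
  move=> hb xT; rewrite inE ffunE; apply/negP => /eqP /(gE _ hb) xg.
  by have := gT (vertex (Ordinal (hb (tag x)))); rewrite -xg xT.
have sigmag b y : in_IJ J' b ->
    (g y \in sigma_of J [ffun i => f i (b i)]) = (y \in sigma_of J' b).
  move=> hb; rewrite !inE ffunE /=; congr (~~ _); apply/eqP/eqP => [|-> //].
  by apply: finj; [exact: ltn_ord | exact: hb].
(* Outside [T] the facet is the image under [g] of a facet of $K(J')$, so the quotient has the right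
   rank. *)
have cFT : #|facetJ J [ffun i => f i (b0 i)] t :\: T| = dimJ n J'.
  transitivity #|g @: facetJ J' b0 t|; last by rewrite card_imset // card_facetJ ?tn.
  have gF y : (g y \in facetJ J [ffun i => f i (b0 i)] t) = (y \in facetJ J' b0 t).
    by have := sigmag b0 y hb0; rewrite !inE => ->.
  apply: eq_card => x; rewrite in_setD.
  have [xT|[y ->]] := TP x.
    rewrite xT; apply/esym/negbTE/negP => /imsetP[y _ xg].
    by have := gT y; rewrite -xg xT.
  by rewrite gT gF mem_imset.
have TF : T \subset facetJ J [ffun i => f i (b0 i)] t.
  apply/subsetP => x /(sigmaT b0 x hb0).
  by apply/subsetP; exact: sigma_sub_facetJ.
have [Q [sQ kQ]] := basis_quotient bF TF cFT.
have QT x : x \in T -> Q *m L x = 0 by move=> xT; apply/kQ/in_span_vertex.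
pose L' y := Q *m L (g y).
have spanE b x : in_IJ J' b ->
    in_span (sigma_of J' b) L' (Q *m x) <->
    in_span (sigma_of J [ffun i => f i (b i)]) L x.
  move=> hb; split=> [[a aE]|[a ->]].
    rewrite -(subrK (\sum_(y in sigma_of J' b) a y *: L (g y)) x).
    apply: in_spanD; last first.
      apply: in_span_bigsum => y yb; apply/in_spanZ/in_span_vertex.
      by rewrite sigmag.
    apply: (@in_span_sub _ _ _ T); first by apply/subsetP => z; apply: sigmaT.
    apply/kQ; rewrite mulmxBr aE mulmx_sumr.
    by under [X in _ - X]eq_bigr do rewrite -scalemxAr; rewrite subrr.
  rewrite mulmx_sumr; apply: in_span_bigsum => v vb; rewrite -scalemxAr.
  apply: in_spanZ; have [vT|[y yE]] := TP v.
    by rewrite QT // -(scale0r 0); apply/in_spanZ; exists (fun=> 0);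
      rewrite big1 // => w _; rewrite scale0r.
  move: vb; rewrite yE sigmag // => yb.
  exact: (in_span_vertex L' yb).
exists L' => b mu hb; split=> [[P [sP kP Pmu]]|[P [sP kP Pmu]]].
  exists (P *m Q); split=> [y|x|x].
  - have [z <-] := sP y; have [x <-] := sQ z; exists x.
    by rewrite mulmxA.
  - by rewrite -mulmxA; split=> [/kP/spanE|/spanE-/(_ hb)/kP]; first exact.
  rewrite ffunE => /(gE _ hb) ->.
  by rewrite -mulmxA; apply: (Pmu (vertex (Ordinal (hb (tag x))))).
(* [P] kills the span of [T], so it descends to the quotient. *)
have [U PU] : exists U, P = U *m Q.
  apply: surj_factor sQ _ => x /kQ xT; apply/kP; apply: in_span_sub xT.
  by apply/subsetP => z; apply: sigmaT.
exists U; split=> [y|z|x xb].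
- by have [x <-] := sP y; exists (Q *m x); rewrite PU mulmxA.
- have [x <-] := sQ z; rewrite mulmxA -PU.
  by split=> [/kP/spanE|/spanE-/(_ hb)/kP]; first exact.
by rewrite mulmxA -PU; apply: (Pmu (g x)); rewrite ffunE /= -xb.
Qed.

(** * Characteristic maps over $K(J)$ and their projections *)

Section Sphere.
Variables (c : coef) (n m : nat) (K : {set {set 'I_m}}).
Hypotheses (sK : simplicial_complex K) (pK : pure_dim n K).
Implicit Types (J : 'I_m -> nat) (a b : {ffun 'I_m -> nat}) (t : {set 'I_m})
  (mu lam : 'I_m -> 'cV[cring c]_n).

Let Kmap mu := charmap (fun s => s \in K) mu.

Lemma zero_in_IJ J : (forall i, 0 < J i)%N -> in_IJ J (a_v2 m).
Proof. by move=> hJ i; rewrite ffunE. Qed.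

Lemma exists_facet : exists2 t, t \in K & #|t| = n.
Proof.
case: sK => K0 _ _; have [_ [t tK /andP[_ /eqP]]] := pK K0.
by exists t.
Qed.

Lemma exists_facet_containing (i : 'I_m) : exists t, [/\ t \in K, #|t| = n & i \in t].
Proof.
case: sK => _ _ /(_ i) /pK[_ [t tK]]; rewrite sub1set => /andP[it /eqP tn].
by exists t.
Qed.

Lemma proj_charmap J (L : VJ J -> 'cV[cring c]_(dimJ n J)) a mu :
  charmapJ K L -> in_IJ J a -> proj_is a L mu -> Kmap mu.
Proof.
move=> LK ha pL t tK tn; apply: (proj_span ha pL tn).
exact: (charmapJ_facetJ sK).
Qed.

(** Every facet of $K(J)$ is some [facetJ J a t], and a projection at [a] lifts the basis on [t] to
    it. *)
Lemma charmapJ_of_proj J (L : VJ J -> 'cV[cring c]_(dimJ n J)) :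
  (forall i, 0 < J i)%N ->
  (forall a, in_IJ J a -> exists2 mu, Kmap mu & proj_is a L mu) -> charmapJ K L.
Proof.
move=> hJ pL S fS cS; have [a [t [ha tK tn ->]]] := faceJ_facetJ pK hJ fS cS.
have [mu muK muL] := pL a ha.
by apply: (proj_basis ha muL tn); apply: muK.
Qed.

Lemma charmapJ_restriction J J' (f : 'I_m -> nat -> nat)
  (L : VJ J -> 'cV[cring c]_(dimJ n J)) :
  (forall i, 0 < J' i)%N ->
  (forall i k, k < J' i -> f i k < J i)%N ->
  (forall i k l, (k < J' i)%N -> (l < J' i)%N -> f i k = f i l -> k = l) ->
  charmapJ K L ->
  exists2 L' : VJ J' -> 'cV[cring c]_(dimJ n J'), charmapJ K L' &
    forall b mu, in_IJ J' b ->
      proj_is b L' mu <-> proj_is [ffun i => f i (b i)] L mu.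
Proof.
move=> hJ' hf finj LK; have [t tK tn] := exists_facet.
have hfI b : in_IJ J' b -> in_IJ J [ffun i => f i (b i)].
  by move=> hb i; rewrite ffunE hf.
have [L' L'P] := restriction hf finj (zero_in_IJ hJ') tn
  (charmapJ_facetJ sK LK (hfI _ (zero_in_IJ hJ')) tK tn).
exists L' => //; apply: charmapJ_of_proj => // b hb.
have [mu muL] := proj_exists (hfI _ hb) tn (charmapJ_facetJ sK LK (hfI _ hb) tK tn).
exists mu; first exact: proj_charmap (hfI _ hb) muL.
exact/L'P.
Qed.

Lemma proj_value J (L : VJ J -> 'cV[cring c]_(dimJ n J)) a mu :
  proj_is a L mu -> exists P : 'M[cring c]_(n, dimJ n J),
    [/\ forall y : 'cV_n, exists x, P *m x = y,
        forall x, P *m x = 0 <-> in_span (sigma_of J a) L x &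
        forall y : VJ J, P *m L y =
          if val (tagged y) == a (tag y) then mu (tag y) else 0].
Proof.
move=> [P [sP kP Pmu]]; exists P; split=> // y.
case: eqP => [/Pmu //|/eqP ya]; apply: (proj_is_sigma0 mu kP).
by rewrite inE.
Qed.

(** By purity [i] lies in a facet; [r] is its coordinate functional in the corresponding basis. *)
Lemma charmap_unimodular mu (i : 'I_m) : Kmap mu ->
  exists r : 'rV[cring c]_n, r *m mu i = 1%:M.
Proof.
move=> muK; have [t [tK tn it]] := exists_facet_containing i.
have [D [_ Dmu]] := dual_basis (muK t tK tn).
by exists (D i); rewrite [LHS]mx11_scalar Dmu // eqxx.
Qed.

(** If [P] projects [L1] and [L2 = M L1], then $PM^{-1}$ projects [L2] to the same
    representative. *)
Lemma proj_DJ J (L1 L2 : VJ J -> 'cV[cring c]_(dimJ n J)) a mu :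
  DJ L1 L2 -> proj_is a L1 mu -> proj_is a L2 mu.
Proof.
move=> [M uM ME] [P [sP kP Pmu]]; exists (P *m invmx M); split=> [y|x|x xa].
- have [x <-] := sP y; exists (M *m x).
  by rewrite -mulmxA mulKmx.
- rewrite -mulmxA; split=> [/kP[b bE]|[b ->]].
    exists b; rewrite -[LHS](mulKVmx uM) bE mulmx_sumr.
    by apply: eq_bigr => v _; rewrite ME scalemxAr.
  apply/kP; exists b; rewrite mulmx_sumr; apply: eq_bigr => v _.
  by rewrite -scalemxAr ME mulKmx.
by rewrite ME -mulmxA mulKmx //; apply: Pmu.
Qed.

End Sphere.

(** * Normal forms *)

(** The zero point [a_v2 m] serves as base point for every [J]; for $k\neq 0$ these are its
    neighbours in $G(J)$. *)
Definition axis_point (m : nat) (i : 'I_m) (k : nat) : {ffun 'I_m -> nat} :=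
  [ffun j => if j == i then k else 0%N].

Definition axis_of (m : nat) (J : 'I_m -> nat) (x : VJ J) : {ffun 'I_m -> nat} :=
  axis_point (tag x) (val (tagged x)).

Definition nonzero_set (m : nat) (a : {ffun 'I_m -> nat}) : {set 'I_m} :=
  [set i | a i != 0%N].

Lemma axis_of_in_IJ (m : nat) (J : 'I_m -> nat) (x : VJ J) :
  (forall i, 0 < J i)%N -> in_IJ J (axis_of x).
Proof. by move=> hJ i; rewrite ffunE; case: eqP => [->|_]; [exact: ltn_ord|]. Qed.

Lemma nonzero_set0 (m : nat) : nonzero_set (a_v2 m) = set0.
Proof. by apply/setP => i; rewrite !inE ffunE. Qed.

Lemma card_nonzero_axis (m : nat) (i : 'I_m) (k : nat) :
  (#|nonzero_set (axis_point i k)| <= 1)%N.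
Proof.
rewrite -(cards1 i); apply/subset_leq_card/subsetP => j.
by rewrite !inE ffunE; case: (j == i).
Qed.

Lemma small_nonzero_set (m : nat) (J : 'I_m -> nat) (a : {ffun 'I_m -> nat}) :
  in_IJ J a -> (#|nonzero_set a| <= 1)%N ->
  a = a_v2 m \/ exists2 x : VJ J, x \in sigma_of J (a_v2 m) & a = axis_of x.
Proof.
move=> ha; rewrite leq_eqVlt => /orP[/cards1P[i si]|]; last first.
  rewrite ltnS leqn0 cards_eq0 => /eqP s0; left; apply/ffunP => i.
  by have := in_set0 i; rewrite -s0 inE ffunE => /negbFE/eqP.
have E j : (a j != 0%N) = (j == i) by rewrite -(in_set1 j) -si inE.
right; exists (vertex (Ordinal (ha i))); first by rewrite inE ffunE /= E eqxx.
apply/ffunP => j; rewrite ffunE /=; case: eqP => [-> //|/eqP ji].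
by apply/eqP; rewrite -[_ == _]negbK E (negbTE ji).
Qed.

(* In a basis extending the images of the vertices [i_k], [k > 1], the matrix
   of a characteristic map has an identity block on these vertices, and is
   determined by the projection [lam] at the base point and by one more row
   [cc x] for each such vertex [x]; [rho] enumerates these vertices. *)
Definition normal_form (c : coef) (n m : nat) (J : 'I_m -> nat)
  (rho : 'I_(\sum_(i < m) (J i).-1) -> VJ J) (lam : 'I_m -> 'cV[cring c]_n)
  (cc : VJ J -> 'I_m -> cring c) (y : VJ J) : 'cV[cring c]_(dimJ n J) :=
  col_mx (if val (tagged y) == 0%N then lam (tag y) else 0)
    (\col_j ((rho j == y)%:R +
       if (val (tagged y) == 0%N) && (tag (rho j) != tag y)
       then cc (rho j) (tag y) else 0)).

Lemma normal_form_base (c : coef) (n m : nat) (J : 'I_m -> nat)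
  (rho : 'I_(\sum_(i < m) (J i).-1) -> VJ J) (lam : 'I_m -> 'cV[cring c]_n)
  (cc : VJ J -> 'I_m -> cring c) :
  injective rho -> (forall j, rho j \in sigma_of J (a_v2 m)) ->
  proj_is (a_v2 m) (normal_form rho lam cc) lam.
Proof.
(* Keeping the upper block works: the vertices [rho j] are sent to the last standard basis vectors,
   which span its kernel. *)
move=> rinj rA; exists (row_mx 1%:M 0).
have PE u v : row_mx (1%:M : 'M[cring c]_n) 0 *m
    (col_mx u v : 'cV_(n + \sum_(i < m) (J i).-1)) = u.
  by rewrite mul_row_col mul1mx mul0mx addr0.
split=> [y|x|x]; first by exists (col_mx y 0); rewrite PE.
  split=> [|[a ->]]; last first.
    rewrite mulmx_sumr big1 // => v; rewrite inE ffunE -scalemxAr PE.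
    by move=> /negbTE ->; rewrite scaler0.
  rewrite -[x]vsubmxK PE => ->.
  have nfr j : normal_form rho lam cc (rho j) = col_mx 0 (col j 1%:M).
    have := rA j; rewrite inE ffunE /normal_form => /negbTE ->.
    congr col_mx; apply/matrixP => k l; rewrite !mxE addr0.
    by rewrite (inj_eq rinj) eq_sym.
  have -> : col_mx 0 (dsubmx x) = \sum_j dsubmx x j 0 *:
      (normal_form rho lam cc (rho j)) :> 'cV_(n + \sum_(i < m) (J i).-1).
    rewrite [X in col_mx 0 X]col_sum_delta.
    rewrite (big_morph (col_mx 0) (id1 := 0) (op1 := +%R)) ?col_mx0 //.
      by apply: eq_bigr => j _; rewrite nfr scale_col_mx scaler0.
    by move=> u v; rewrite add_col_mx addr0.
  apply: in_span_bigsum => j _; apply/in_spanZ/in_span_vertex; exact: rA.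
by rewrite ffunE /normal_form => xz; rewrite PE xz.
Qed.

Lemma normal_form_axis (c : coef) (n m : nat) (J : 'I_m -> nat)
  (rho : 'I_(\sum_(i < m) (J i).-1) -> VJ J) (lam mu : 'I_m -> 'cV[cring c]_n)
  (cc : VJ J -> 'I_m -> cring c) (j : 'I_(\sum_(i < m) (J i).-1))
  (U : 'M[cring c]_n) (t : {set 'I_m}) :
  (forall i, 0 < J i)%N -> injective rho ->
  (forall j, rho j \in sigma_of J (a_v2 m)) ->
  tag (rho j) \in t -> #|t| = n -> is_basis t lam -> is_basis t mu ->
  U *m lam (tag (rho j)) = 0 ->
  (forall i, i != tag (rho j) ->
     U *m lam i = mu i - cc (rho j) i *: mu (tag (rho j))) ->
  proj_is (axis_of (rho j)) (normal_form rho lam cc) mu.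
Proof.
move=> hJ rinj rA xt tn blam bmu U0 UE.
have nfb := normal_form_base lam cc rinj rA.
have h0 : in_IJ J (a_v2 m) by apply: zero_in_IJ.
have bF := proj_basis h0 nfb tn blam.
(* The two points differ only in the coordinate [tag (rho j)], over which both facets contain all
   vertices. *)
have FE : facetJ J (axis_of (rho j)) t = facetJ J (a_v2 m) t.
  apply/setP => y; rewrite !inE !ffunE.
  case: (eqVneq (tag y) (tag (rho j))) => // ty.
  have yt : tag y \in t by rewrite ty.
  by rewrite yt !orbT.
(* The lower block contributes its [j]-th entry times $\mu(v)$, with [v] the tag of [rho j]: this is
   $\mu(v)$ at [rho j] and the multiple subtracted in [UE] at the base vertices over the other [i].
   The base vertex over [v] is killed by [U0]. *)
apply: (@proj_intro _ _ _ _ _ _ t _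
  (row_mx U (mu (tag (rho j)) *m delta_mx 0 j))) => //.
- exact: axis_of_in_IJ.
- by rewrite FE.
move=> y; rewrite mul_row_col -mulmxA -rowE.
have -> : row j (\col_j ((rho j == y)%:R +
       if (val (tagged y) == 0%N) && (tag (rho j) != tag y)
       then cc (rho j) (tag y) else 0)) = ((rho j == y)%:R +
       if (val (tagged y) == 0%N) && (tag (rho j) != tag y)
       then cc (rho j) (tag y) else 0)%:M.
  by apply/matrixP => k l; rewrite !mxE (ord1 k) (ord1 l).
rewrite mul_mx_scalar ffunE.
have rj : val (tagged (rho j)) != 0%N by have := rA j; rewrite inE ffunE.
case: (eqVneq (val (tagged y)) 0%N) => [y0|y0] /=.
  have -> : (rho j == y) = false by apply: contraNF rj => /eqP ->; rewrite y0.
  rewrite add0r (eq_sym (tag (rho j))) y0.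
  case: (eqVneq (tag y) (tag (rho j))) => [->|/UE ->] /=.
    by rewrite U0 scale0r addr0 eq_sym (negbTE rj).
  by rewrite subrK.
rewrite mulmx0 add0r addr0.
case: (eqVneq (rho j) y) => [->|ry]; first by rewrite !eqxx scale1r.
rewrite scale0r; case: (eqVneq (tag y) (tag (rho j))) => [ty|_].
  case: eqP => // vy; case/eqP: ry; exact/esym/vertexP.
by rewrite (negbTE y0).
Qed.

(** The upper block of [Phi] is the projection at the base point. The row for [x] is [r x] composed
    with the projection at [axis_of x]: it is 1 at [x], vanishes at the other nonbase vertices and
    at the base vertex over the tag of [x], and gives the extra entries at the other base
    vertices. *)
Lemma normal_form_reach (c : coef) (n m : nat) (J : 'I_m -> nat)
  (rho : 'I_(\sum_(i < m) (J i).-1) -> VJ J)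
  (L : VJ J -> 'cV[cring c]_(dimJ n J)) (lam : 'I_m -> 'cV[cring c]_n)
  (q : VJ J -> 'I_m -> 'cV[cring c]_n) (r : VJ J -> 'rV[cring c]_n) :
  (forall j, rho j \in sigma_of J (a_v2 m)) ->
  proj_is (a_v2 m) L lam ->
  (forall x, x \in sigma_of J (a_v2 m) -> proj_is (axis_of x) L (q x)) ->
  (forall x, x \in sigma_of J (a_v2 m) -> r x *m q x (tag x) = 1%:M) ->
  exists Phi : 'M[cring c]_(dimJ n J), forall y,
    Phi *m L y = normal_form rho lam (fun x i => (r x *m q x i) 0 0) y.
Proof.
move=> rA /proj_value[P0 [_ _ P0E]] pL rq.
have /fin_all_exists[P PE] j : exists P : 'M[cring c]_(n, dimJ n J),
    forall y : VJ J, P *m L y =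
      if val (tagged y) == axis_of (rho j) (tag y) then q (rho j) (tag y) else 0.
  by have /proj_value[P [_ _ PE]] := pL _ (rA j); exists P.
exists (col_mx P0 (\matrix_j (r (rho j) *m P j))) => y.
rewrite mul_col_mx P0E ffunE; congr col_mx; apply/matrixP => j k.
transitivity ((r (rho j) *m (P j *m L y)) 0 0).
  by rewrite (ord1 k) mulmxA !mxE; apply: eq_bigr => l _; rewrite !mxE.
rewrite PE [RHS]mxE /=; case: (eqVneq (rho j) y) => [<-|ry].
  by rewrite ffunE !eqxx andbF addr0 (rq _ (rA j)) mxE eqxx.
rewrite add0r ffunE (eq_sym (tag (rho j))).
case: (eqVneq (tag y) (tag (rho j))) => [ty|_]; last first.
  by case: (val (tagged y) == 0%N) => //=; rewrite mulmx0 mxE.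
rewrite andbF; case: eqP => [vy|_]; last by rewrite mulmx0 mxE.
by case/eqP: ry; apply/esym/vertexP.
Qed.

(** Supplies the matrix that [normal_form_axis] asks for. The factor $1 - l_1(v)\,r$ projects along
    $l_1(v)$, so after [P1] it kills both copies of [v] in the wedge; it therefore factors through
    [P2], and [U] is the factor. *)
Lemma edge_factor (c : coef) (n m : nat) (K : {set {set 'I_m}}) (v : 'I_m)
  (l1 l2 : 'I_m -> 'cV[cring c]_n) (r : 'rV[cring c]_n) :
  edgeD K v l1 l2 -> r *m l1 v = 1%:M ->
  exists U : 'M[cring c]_n, U *m l2 v = 0 /\
    forall i, i != v -> U *m l2 i = l1 i - (r *m l1 i) 0 0 *: l1 v.
Proof.
move=> [L [LK /proj_value[P1 [_ _ P1E]] /proj_value[P2 [sP2 kP2 P2E]]]] rl.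
pose A := (1%:M - l1 v *m r) *m P1.
have AE x : A *m L x = (1%:M - l1 v *m r) *m (P1 *m L x) by rewrite mulmxA.
have Jv i : (0 < Jwed v i)%N by rewrite /Jwed; case: eqP.
have Al i : (1%:M - l1 v *m r) *m l1 i = l1 i - (r *m l1 i) 0 0 *: l1 v.
  by rewrite mulmxBl mul1mx -mulmxA -mul_mx_scalar -mx11_scalar.
(* The kernel of [P2] is spanned by the copy of [v] with index 1, which [P1] sends to [l1 v]. *)
have [U AU] : exists U, A = U *m P2.
  apply: surj_factor sP2 _ => x /kP2; apply: mulmx_span0 => y.
  rewrite inE AE P1E !ffunE; case: y => i k /= k0.
  have := ltn_ord k; rewrite {2}/Jwed; case: eqP => [iv k2|_ k1]; last first.
    by case/negP: k0; rewrite -leqn0.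
  have -> : val k == 1%N by rewrite eqn_leq lt0n k0 -ltnS k2.
  by rewrite iv Al rl mxE eqxx mulr1n scale1r subrr.
pose x i : VJ (Jwed v) := vertex (Ordinal (Jv i)).
have Ux i : U *m l2 i = A *m L (x i) by rewrite AU -mulmxA P2E ffunE eqxx.
exists U; split=> [|i iv]; rewrite Ux AE P1E ffunE /=.
  by rewrite eqxx mulmx0.
by rewrite (negbTE iv) eqxx Al.
Qed.

(** * Puzzles *)

Section Puzzles.
Variables (c : coef) (n m : nat) (K : {set {set 'I_m}}).
Hypotheses (sK : simplicial_complex K) (pK : pure_dim n K).
Implicit Types (J : 'I_m -> nat) (a b : {ffun 'I_m -> nat}) (t : {set 'I_m})
  (p : {ffun 'I_m -> nat} -> 'I_m -> 'cV[cring c]_n).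

(** Both maps are carried to the same normal form [N]. As [N] spans, the carrying matrices are
    surjective, hence invertible, and can be compared. *)
Lemma proj_axes_DJ J (L1 L2 : VJ J -> 'cV[cring c]_(dimJ n J)) p :
  (forall i, 0 < J i)%N ->
  (forall a, in_IJ J a -> (#|nonzero_set a| <= 1)%N ->
     [/\ charmap (fun s => s \in K) (p a),
         proj_is a L1 (p a) & proj_is a L2 (p a)]) -> DJ L1 L2.
Proof.
move=> hJ pL; have h0 := zero_in_IJ hJ.
have s0 : (#|nonzero_set (a_v2 m)| <= 1)%N by rewrite nonzero_set0 cards0.
have hx (x : VJ J) := pL _ (axis_of_in_IJ x hJ) (card_nonzero_axis _ _).
have [rho [rinj rA _ _]] := set_enumeration (card_sigma h0).
have /fin_all_exists[r rE] (x : VJ J) :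
    exists r : 'rV[cring c]_n, r *m p (axis_of x) (tag x) = 1%:M.
  by apply: (charmap_unimodular sK pK) => //; have [] := hx x.
have [t tK tn] := exists_facet sK pK.
pose N := normal_form rho (p (a_v2 m)) (fun x i => (r x *m p (axis_of x) i) 0 0).
have [q0 _ _] := pL _ h0 s0.
have [spN _] := proj_basis h0 (normal_form_base _ _ rinj rA : proj_is _ N _) tn
  (q0 t tK tn).
have reach (L : VJ J -> 'cV[cring c]_(dimJ n J)) :
    proj_is (a_v2 m) L (p (a_v2 m)) ->
    (forall x : VJ J, proj_is (axis_of x) L (p (axis_of x))) ->
    exists2 Phi, Phi \in unitmx & forall y, Phi *m L y = N y.
  move=> Lp0 Lp; have [Phi PhiE] := normal_form_reach rA Lp0
    (fun x _ => Lp x) (fun x _ => rE x).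
  exists Phi => //; have [S PS] : exists S, Phi *m S = 1%:M.
    apply: surj_right_inverse => y; have [b ->] := spN y.
    exists (\sum_(v in facetJ J (a_v2 m) t) b v *: L v).
    by rewrite mulmx_sumr; apply: eq_bigr => v _; rewrite -scalemxAr PhiE.
  by have [] := mulmx1_unit PS.
have [_ p1 p2] := pL _ h0 s0.
have [P1 u1 E1] := reach L1 p1 (fun x => let: And3 _ l _ := hx x in l).
have [P2 u2 E2] := reach L2 p2 (fun x => let: And3 _ _ l := hx x in l).
exists (invmx P2 *m P1); first by rewrite unitmx_mul unitmx_inv u2 u1.
by move=> v; rewrite -mulmxA E1 -E2 mulKmx.
Qed.

Lemma realizes_charmap J (L : VJ J -> 'cV[cring c]_(dimJ n J)) p a :
  realizes K L p -> in_IJ J a -> charmap (fun s => s \in K) (p a).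
Proof. by move=> [LK Lp] ha; apply: (proj_charmap sK LK ha (Lp a ha)). Qed.

Lemma increasing_injective J (f : 'I_m -> nat -> nat) :
  (forall i k l, (k < l)%N -> (l < J i)%N -> (f i k < f i l)%N) ->
  forall i k l, (k < J i)%N -> (l < J i)%N -> f i k = f i l -> k = l.
Proof.
move=> fS i k l kJ lJ fkl; case: (ltngtP k l) => // [kl|lk].
  by have := fS i k l kl lJ; rewrite fkl ltnn.
by have := fS i l k lk kJ; rewrite fkl ltnn.
Qed.

Lemma realizable_subsquares J p :
  realizable K J p -> subsquares_realizable K J p.
Proof.
move=> [L [LK Lp]] J' f hJ' _ hf fS.
have J'gt0 i : (0 < J' i)%N by case/andP: (hJ' i).
have [L' L'K L'P] := charmapJ_restriction sK pK J'gt0 hf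
  (increasing_injective fS) LK.
exists L'; split=> // b hb; apply/L'P => //; apply: Lp => i.
by rewrite ffunE hf.
Qed.

Lemma puzzle_realizable J p : (forall i, 0 < J i)%N ->
  is_puzzle K J p -> subsquares_realizable K J p -> realizable K J p.
Proof.
move=> hJ [pc pe] psq; have h0 := zero_in_IJ hJ.
have hx (x : VJ J) := axis_of_in_IJ x hJ.
have [rho [rinj rA Ar _]] := set_enumeration (card_sigma h0).
have /fin_all_exists[r rE] (x : VJ J) :
    exists r : 'rV[cring c]_n, r *m p (axis_of x) (tag x) = 1%:M.
  by apply: (charmap_unimodular sK pK) => //; apply: pc.
(* The entries are forced: any realization of [p] has this normal form. *)
pose L := normal_form rho (p (a_v2 m)) (fun x i => (r x *m p (axis_of x) i) 0 0).
have L0 : proj_is (a_v2 m) L (p (a_v2 m)) by apply: normal_form_base.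
have Lx (x : VJ J) : x \in sigma_of J (a_v2 m) ->
    proj_is (axis_of x) L (p (axis_of x)).
  move=> /[dup] x0 /Ar[j xj].
  (* The facet must contain [tag x] for the facets at the base point and at [axis_of x] to
     coincide. *)
  have [t [tK tn xt]] := exists_facet_containing sK pK (tag x).
  have e : edgeD K (tag x) (p (axis_of x)) (p (a_v2 m)).
    apply: pe => //; split=> [|i ix]; rewrite !ffunE ?(negbTE ix) // eqxx.
    by apply/eqP; move: x0; rewrite inE ffunE.
  have [U [U0 UE]] := edge_factor e (rE x).
  move: xt U0 UE; rewrite {}xj => xt U0 UE.
  by apply: (@normal_form_axis _ _ _ _ _ _ _ _ _ U t) => //; apply: pc.
have Lp a : in_IJ J a -> proj_is a L (p a).
  have [k] := ubnP #|nonzero_set a|; elim: k a => // k IH a; rewrite ltnS => ak ha.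
  have [a1|/card_gt1P[x [y [xa ya xy]]]] := leqP #|nonzero_set a| 1.
    by have [->|[x x0 ->]] := small_nonzero_set ha a1 => //; apply: Lx.
  pose S := [set x; y].
  pose J' i := if i \in S then 2%N else 1%N.
  (* On [S] index 0 resets the coordinate to the base value and index 1 keeps [a i]; the other
     coordinates stay fixed at [a i]. *)
  pose f i k := if (i \in S) && (k == 0)%N then 0%N else a i.
  have Sa i : i \in S -> (0 < a i)%N.
    by rewrite !inE lt0n => /orP[/eqP->|/eqP->]; move: xa ya; rewrite !inE.
  have hJ' i : (0 < J' i)%N by rewrite /J'; case: ifP.
  have hf i l : (l < J' i)%N -> (f i l < J i)%N.
    by rewrite /f; case: ifP => // _ _; apply: ha.
  have fS i l l' : (l < l')%N -> (l' < J' i)%N -> (f i l < f i l')%N.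
    rewrite /J' /f; case: (boolP (i \in S)) => [/Sa ai|_].
      by case: l l' => [|l] [|[|l']].
    by case: l'.
  have cS : #|[set i | J' i == 2%N]| = 2%N.
    transitivity #|S|; last by rewrite cards2 xy.
    by apply: eq_card => i; rewrite inE /J'; case: (i \in S).
  pose fs b := [ffun i => f i (b i)] : {ffun 'I_m -> nat}.
  have hfs b : in_IJ J' b -> in_IJ J (fs b).
    by move=> hb i; rewrite ffunE hf.
  (* The three corners other than [a]: at least one of [x], [y] is reset, so fewer nonzero
     coordinates remain. *)
  have Lfs b : in_IJ J' b -> (#|nonzero_set b| <= 1)%N -> proj_is (fs b) L (p (fs b)).
    move=> hb b1; apply: IH; last exact: hfs.
    apply: leq_trans ak; apply: proper_card; apply/properP; split.
      apply/subsetP => i; rewrite !inE ffunE /f.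
      by case: ifP.
    have [z zS zb] : exists2 z, z \in S & z \notin nonzero_set b.
      apply/exists_inP; apply: contraTT b1; rewrite -ltnNge negb_exists.
      move=> /forallP Sb; apply/card_gt1P; exists x, y.
      have := Sb x; have := Sb y; rewrite !inE !eqxx orbT /= !negbK.
      by move=> -> ->.
    exists z; first by rewrite inE -lt0n Sa.
    by move: zb; rewrite !inE ffunE /f zS => /negPn ->.
  have [L2 [L2K L2p]] : realizable K J' (fun b => p (fs b)).
    by apply: psq => // i; rewrite /J'; case: ifP.
  have [t tK tn] := exists_facet sK pK.
  have b0 := zero_in_IJ hJ'.
  have s0 : (#|nonzero_set (a_v2 m)| <= 1)%N by rewrite nonzero_set0 cards0.
  (* [L] is not yet known to be a characteristic map, but one facet basis, at the fully reset
     corner, is enough to restrict it. *)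
  have [L3 L3P] := restriction hf (increasing_injective fS) b0 tn
    (proj_basis (hfs _ b0) (Lfs _ b0 s0) tn (pc _ (hfs _ b0) t tK tn)).
  have L23 : DJ L2 L3.
    apply: (proj_axes_DJ (p := fun b => p (fs b))) hJ' _ => b hb b1.
    by split; [apply: pc; apply: hfs | exact: L2p | apply/L3P => //; apply: Lfs].
  (* The fourth corner, which corresponds to [a]. *)
  pose b1 := [ffun i => (i \in S : nat)] : {ffun 'I_m -> nat}.
  have hb1 : in_IJ J' b1 by move=> i; rewrite ffunE /J'; case: ifP.
  have fb1 : fs b1 = a.
    by apply/ffunP => i; rewrite !ffunE /f; case: ifP => // /andP[->].
  rewrite -fb1; apply/(L3P _ _ hb1)/(proj_DJ L23).
  exact: L2p.
exists L; split=> //; apply: (charmapJ_of_proj pK) => // a ha.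
by exists (p a); [apply: pc | apply: Lp].
Qed.

(** * From characteristic maps to puzzles *)

(** Finite choice needs a finite index type, so points of $I(J)$ are encoded as functions into
    ordinals bounded by the largest [J i]; codes outside $I(J)$ get the zero map. *)
Lemma proj_family J (L : VJ J -> 'cV[cring c]_(dimJ n J)) :
  charmapJ K L -> exists p, forall a, in_IJ J a -> proj_is a L (p a).
Proof.
move=> LK; have [t tK tn] := exists_facet sK pK.
pose val_of (h : {ffun 'I_m -> 'I_(\max_i J i).+1}) : {ffun 'I_m -> nat} :=
  [ffun i => val (h i)].
have /fin_all_exists[g gP] h : exists mu : 'I_m -> 'cV[cring c]_n,
    in_IJ J (val_of h) -> proj_is (val_of h) L mu.
  have [/forallP hJ|hJ] := boolP [forall i, (val_of h i < J i)%N].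
    have [mu muP] := proj_exists hJ tn (charmapJ_facetJ sK LK hJ tK tn).
    by exists mu.
  by exists (fun=> 0) => hI; case/negP: hJ; apply/forallP.
exists (fun a => g [ffun i => inord (a i)]) => a ha.
have aE : val_of [ffun i => inord (a i)] = a.
  apply/ffunP => i; rewrite !ffunE /= inordK // ltnS.
  by apply: leq_trans (ltnW (ha i)) _; apply: leq_bigmax.
by have := gP [ffun i => inord (a i)]; rewrite aE; apply.
Qed.

Lemma proj_edge J (L : VJ J -> 'cV[cring c]_(dimJ n J)) a b (v : 'I_m)
  (l1 l2 : 'I_m -> 'cV[cring c]_n) :
  charmapJ K L -> in_IJ J a -> in_IJ J b -> gedge v a b ->
  proj_is a L l1 -> proj_is b L l2 -> edgeD K v l1 l2.
Proof.
move=> LK ha hb [vab ab] pa pb.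
(* Index 1 goes to [a v] and 0 to [b v], matching [a_v1 v] and [a_v2 m]; the order of [a v] and
   [b v] may be reversed. *)
pose f i k := if (i == v) && (k == 0)%N then b i else a i.
have hJ i : (0 < Jwed v i)%N by rewrite /Jwed; case: ifP.
have hf i k : (k < Jwed v i)%N -> (f i k < J i)%N.
  by rewrite /f => _; case: ifP => _; [apply: hb | apply: ha].
have finj i k l : (k < Jwed v i)%N -> (l < Jwed v i)%N -> f i k = f i l -> k = l.
  rewrite /f /Jwed; case: (eqVneq i v) => [->|_].
    by case: k l => [|[|k]] [|[|l]] //= _ _ /esym.
  by case: k l => [|k] [|l].
have [L' L'K L'P] := charmapJ_restriction sK pK hJ hf finj LK.
exists L'; split=> //; apply/L'P.
- by move=> i; rewrite ffunE /Jwed; case: ifP.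
- rewrite (_ : [ffun i => _] = a) //; apply/ffunP => i; rewrite !ffunE /f.
  by case: (eqVneq i v) => [->|].
- exact: zero_in_IJ.
rewrite (_ : [ffun i => _] = b) //; apply/ffunP => i; rewrite !ffunE /f.
by case: (eqVneq i v) => //= /ab.
Qed.

End Puzzles.

Theorem mainTheorem11 (c : coef) (m n : nat) (K : {set {set 'I_m}})
  (hK : star_shaped_sphere n K) (J : 'I_m -> nat) (hJ : forall i, (0 < J i)%N) :
  (* a puzzle is realizable iff all its subsquares are realizable *)
  (forall p : {ffun 'I_m -> nat} -> 'I_m -> 'cV[cring c]_n,
      is_puzzle K J p -> (realizable K J p <-> subsquares_realizable K J p)) /\
  (* the map Lambda |-> (alpha |-> proj_{sigma(alpha)} Lambda) is a bijection
     from D-J classes over K(J) onto puzzles with realizable subsquares: *)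
  (* (well-defined, with values in the target) *)
  (forall L : VJ J -> 'cV[cring c]_(dimJ n J), charmapJ K L ->
      exists p, [/\ is_puzzle K J p, realizes K L p & subsquares_realizable K J p]) /\
  (forall (L1 L2 : VJ J -> 'cV[cring c]_(dimJ n J)) p,
      realizes K L1 p -> charmapJ K L2 -> DJ L1 L2 -> realizes K L2 p) /\
  (* (injective on D-J classes) *)
  (forall (L1 L2 : VJ J -> 'cV[cring c]_(dimJ n J)) p,
      realizes K L1 p -> realizes K L2 p -> DJ L1 L2) /\
  (* (surjective) *)
  (forall p : {ffun 'I_m -> nat} -> 'I_m -> 'cV[cring c]_n,
      is_puzzle K J p -> subsquares_realizable K J p ->
      exists L : VJ J -> 'cV[cring c]_(dimJ n J), realizes K L p).
Proof.
case: hK => sK pK _; split=> [p pp|].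
  split; [exact: realizable_subsquares | exact: puzzle_realizable].
split=> [L LK|].
  have [p Lp] := proj_family sK pK LK.
  have pR : realizes K L p by [].
  exists p; split=> //; last by apply: realizable_subsquares => //; exists L.
  split=> [a ha|a b v ha hb ab]; first exact: realizes_charmap pR ha.
  by apply: (proj_edge sK pK LK ha hb ab); apply: Lp.
split=> [L1 L2 p [_ Lp] LK D|].
  by split=> // a ha; apply: proj_DJ D (Lp a ha).
split=> [L1 L2 p R1 R2|p]; last exact: puzzle_realizable.
(* Equal projections at the base point and its neighbours already determine the D-J class. *)
apply: (proj_axes_DJ sK pK (p := p)) => // a ha _.
by split; [exact: realizes_charmap R1 ha | exact: R1.2 | exact: R2.2].
Qed.
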